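(* Let $c>0$, $x>0$, $\alpha\in(0,1)$, and let $g:[0,\infty)\to\mathbb R$ be a measurable locally bounded function. Assume that $y$ satisfies the equation $$y(t)=x+c\int_0^t|y(s)|^\alpha ds+g(t),\quad t\ge0.$$ Assume that $\lim_{t\to\infty}y(t)=+\infty$ and that there exist a sequence $\{t_n\}$ with $\lim_{n\to\infty}t_n=\infty$ and a function $h$ with $h(t)=o(t^{\frac1{1-\alpha}})$, $t\to\infty$, such that, for all $n$, $$|g(t)-g(t_n)|\le h(t-t_n),\quad t\ge t_n.$$ Then $$y(t)\sim (c(1-\alpha)t)^{\frac1{1-\alpha}},\quad t\to\infty.$$
   Context: All functions ($y$, $g$, $h$) are assumed to be measurable and locally bounded on $[0,\infty)$. The notation $u(t)\sim v(t)$, $t\to\infty$, means $\lim_{t\to\infty}u(t)/v(t)=1$. *)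

(* Defs.v *)
From mathcomp Require Export all_boot all_order all_algebra.
From mathcomp Require Export all_classical all_reals all_analysis.
Export Order.TTheory GRing.Theory Num.Theory numFieldNormedType.Exports.

Set Implicit Arguments.
Unset Strict Implicit.
Unset Printing Implicit Defensive.

Local Open Scope classical_set_scope.
Local Open Scope ring_scope.

(* Lets the library's Landau notations be used at +oo. *)
Canonical pinfty_filter_on (R : numFieldType) : filter_on R :=
  FilterType (pinfty_nbhs R) (@proper_pinfty_nbhs R).

(* Functions on [0, oo) are represented by functions on R whose values at
   negative arguments are never constrained. *)
Definition measurable_locally_bounded (R : realType) (f : R -> R) : Prop :=
  measurable_fun (`[0, +oo[%classic : set R) f /\
  [locally [bounded f t | t in (`[0, +oo[%classic : set R)]].

(* The limit of the quotient; the library's [u ~_F v] is instead the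
   formulation [u = v + o(v)]. *)
Definition asymp_equiv_pinfty (R : realType) (u v : R -> R) : Prop :=
  u t / v t @[t --> +oo] --> (1 : R).

(* Main.v *)
Require Import Defs.
From mathcomp Require Import lra ring.

(** Write [p = 1 / (1 - alpha)], so that [alpha * p = p - 1]; the claim is
    [y t ~ (gam * t)^p] with [gam = c / p].  This profile is the solution of
    [z' = c z^alpha] issued from 0, and the point is that neither the starting
    value nor the perturbation [g] is felt at the scale [t^p].

    Restart the equation at a time [tau] taken from the sequence [t_n]:
    [y t = y tau + c * int_tau^t |y|^alpha + (g t - g tau)], where
    [|g t - g tau| <= h (t - tau) <= C + eps * (t - tau)^p].  The constant [C]
    depends on [eps] only, not on [tau] ([restartable_solution]).  A shifted
    power [K * (t + D)^p] satisfies
    [c * int_tau^t (K (s + D)^p)^alpha ds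
      = gam * K^alpha * ((t + D)^p - (tau + D)^p)],
    and [gam * K^alpha] is below [K] when [K > gam^p] and above it when
    [K < gam^p].  The gap between the two absorbs [eps * (t - tau)^p], so a
    shifted power with [K > gam^p] is a strict supersolution once [D] is large
    enough for it to start well above [y tau + C], and one with [K < gam^p] is a
    strict subsolution once it starts well below [y tau - C].  For the latter,
    [tau] is chosen so late that [y tau - C] is as large as needed; this is possible
    because [y t --> +oo] and [C] does not depend on [tau].

    Super- and subsolutions stay above and below [y] ([upper_barrier],
    [lower_barrier]).  As [y] need not be continuous, this is proved by induction
    along the half-line ([right_induction]): only the integral term is compared,
    and it is continuous and monotone.  Since [(t + D)^p ~ t^p], letting [K] tend
    to [gam^p] from both sides gives the limit ([cvg_rate]). *)

Set Implicit Arguments.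
Unset Strict Implicit.
Unset Printing Implicit Defensive.

Local Open Scope classical_set_scope.
Local Open Scope ring_scope.

(** * Locally bounded functions and integrals of powers *)

Lemma bounded_on_segment (R : realType) (f : R -> R) (T : R) :
  measurable_locally_bounded f ->
  exists M : R, forall t : R, 0 <= t <= T -> `|f t| <= M.
Proof.
move=> [_ fbd].
have /compact_near_coveringP cpt := @segment_compact R 0 T.
have /cpt : forall t, `[0, T]%classic t ->
    \forall t' \near t & M \near (+oo : set_system R), 0 <= t' -> `|f t'| <= M.
  move=> t; rewrite /= in_itv /= => /andP[t0 _].
  have [|M0 [_ fM0]] := fbd t.
    by rewrite /= in_itv /= t0.
  have := fM0 (M0 + 1) (ltr_pwDr ltr01 (lexx _)).
  rewrite /within /= => fM.
  near=> t' M => /= t'0.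
  apply: (@le_trans _ _ (M0 + 1)).
    suff: `[0, +oo[%classic t' by near: t'.
    by rewrite /= in_itv /= t'0.
  by near: M; apply: nbhs_pinfty_ge; exact: num_real.
move=> /pinfty_ex_gt0 [M _ fM]; exists M => t /andP[t0 tT].
by apply: fM => //=; rewrite in_itv /= t0 tT.
Unshelve. all: by end_near. Qed.

Lemma integrable_powR_norm (R : realType) (y : R -> R) (alpha a b : R) :
  0 <= alpha -> 0 <= a -> measurable_locally_bounded y ->
  lebesgue_measure.-integrable `[a, b] (EFin \o (fun s => `|y s| `^ alpha)).
Proof.
move=> alpha0 a0 ylb; have [M yM] := bounded_on_segment b ylb.
apply: measurable_bounded_integrable => //=.
- by rewrite lebesgue_measure_itv /= -EFinD; case: ifP => _; rewrite ltry.
- suff : measurable_fun (`[0, +oo[%classic : set R)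
      (fun s : R => `|y s| `^ alpha).
    apply: measurable_funS => //.
    by move=> s /=; rewrite !in_itv /= andbT => /andP[/(le_trans a0)].
  apply: (measurableT_comp (@measurable_realfun.measurable_powR R alpha)).
  by apply: measurableT_comp => //; exact: ylb.1.
- exists (M `^ alpha); split; first exact: num_real.
  move=> B MB s /=; rewrite in_itv /= => /andP[/(le_trans a0) s0 sb].
  rewrite ger0_norm ?powR_ge0 //; apply: le_trans (ltW MB).
  have yMs : `|y s| <= M by apply: yM; rewrite s0.
  by rewrite ge0_ler_powR // nnegrE // (le_trans _ yMs).
Qed.

Lemma powR_shift_continuous (R : realType) (D r s : R) :
  0 < s + D -> {for s, continuous (fun t : R => (t + D) `^ r)}.
Proof.
move=> sD0; apply: (@continuous_comp R R R (fun t : R => t + D) (@powR R ^~ r)).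
  by apply: cvgD; [exact: cvg_id | exact: cvg_cst].
apply: differentiable_continuous; apply/derivable1_diffP.
by have [] := is_derive1_powR r sD0.
Qed.

Lemma Rintegral_powR_shift (R : realType) (p D a b : R) :
  0 < p -> 0 < a + D -> a <= b ->
  lebesgue_measure.-integrable `[a, b] (EFin \o (fun s => (s + D) `^ (p - 1))) /\
  \int[lebesgue_measure]_(s in `[a, b]) ((s + D) `^ (p - 1)) =
    p^-1 * ((b + D) `^ p - (a + D) `^ p).
Proof.
move=> p0 aD ab.
have pos s : a <= s -> 0 < s + D.
  by move=> ?; rewrite (lt_le_trans aD) // lerD2r.
have cf : {within `[a, b], continuous (fun s => (s + D) `^ (p - 1))}.
  apply: continuous_in_subspaceT => s; rewrite inE /= in_itv /= => /andP[as_ _].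
  exact/powR_shift_continuous/pos.
split.
  apply: continuous_compact_integrable => //; exact: segment_compact.
move: ab; rewrite le_eqVlt => /predU1P[<-|ab].
  by rewrite set_itv1 Rintegral_set1 subrr mulr0.
pose F (s : R) := p^-1 * (s + D) `^ p.
have cF s : a <= s -> {for s, continuous F}.
  move=> as_; apply: cvgM; first exact: cvg_cst.
  exact/powR_shift_continuous/pos.
have dF s : a <= s -> is_derive s 1 F ((s + D) `^ (p - 1)).
  move=> /pos sD.
  have h := is_derive1_powR p sD.
  have hc : is_derive s 1 (fun t : R => (t + D) `^ p) (p * (s + D) `^ (p - 1)).
    have hs : is_derive s 1 (fun t : R => t + D) 1.
      have := is_deriveD (is_derive_id s 1) (is_derive_cst D s 1).
      by rewrite addr0.
    have := @is_derive1_comp R (@powR R ^~ p) (fun t : R => t + D) s _ _ h hs.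
    by rewrite mulr1.
  have := is_deriveZ p^-1 hc.
  by rewrite /GRing.scale /= mulrA mulVf ?gt_eqF // mul1r.
rewrite /Rintegral (continuous_FTC2 (F := F) ab cf) //.
- by rewrite -EFinB /= /F mulrBr.
- split.
  + move=> s; rewrite in_itv /= => /andP[/ltW as_ _].
    by have [] := dF s as_.
  + exact/cvg_at_right_filter/cF.
  + exact/cvg_at_left_filter/cF/ltW.
- move=> s; rewrite in_itv /= => /andP[/ltW as_ _].
  by rewrite derive1E; have [] := dF s as_.
Qed.

Section IntegralComparison.
Variables (R : realType) (y : R -> R) (alpha p : R).
Hypotheses (alpha0 : 0 <= alpha) (p0 : 0 < p) (alphap : alpha * p = p - 1).
Hypothesis (ylb : measurable_locally_bounded y).

(* The relation [alpha * p = p - 1] makes powers of order [p] integrate to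
   themselves: [alpha]-th powers have order [p - 1]. *)
Let powR_barrier (K v : R) : 0 <= K -> 0 <= v ->
  (K * v `^ p) `^ alpha = K `^ alpha * v `^ (p - 1).
Proof.
by move=> K0 v0; rewrite powRM ?powR_ge0 // -powRrM [p * _]mulrC alphap.
Qed.

Let Rintegral_barrier (K tau D s : R) :
  0 <= K -> 0 < tau + D -> tau <= s ->
  lebesgue_measure.-integrable `[tau, s[
    (EFin \o (fun u => (K * (u + D) `^ p) `^ alpha)) /\
  \int[lebesgue_measure]_(u in `[tau, s[) ((K * (u + D) `^ p) `^ alpha) =
    K `^ alpha * (p^-1 * ((s + D) `^ p - (tau + D) `^ p)).
Proof.
move=> K0 tauD taus.
have [int_cc int_eq] := Rintegral_powR_shift p0 tauD taus.
have int_co : lebesgue_measure.-integrable `[tau, s[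
    (EFin \o (fun u => (u + D) `^ (p - 1))).
  by apply: integrableS int_cc => //; exact: subset_itv_co_cc.
have E : {in `[tau, s[%classic, (fun u => (K * (u + D) `^ p) `^ alpha) =1
    (fun u => K `^ alpha * (u + D) `^ (p - 1))}.
  move=> u; rewrite inE /= in_itv /= => /andP[tauu _].
  by apply: powR_barrier => //; rewrite (le_trans (ltW tauD)) // lerD2r.
split.
  apply: eq_integrable (integrableZl _ (K `^ alpha) int_co) => //.
  by move=> u /E /= ->.
rewrite (eq_Rintegral lebesgue_measure E) RintegralZl //.
by rewrite Rintegral_itv_bndo_bndc // int_eq.
Qed.

Let integrable_co (tau s : R) : 0 <= tau ->
  lebesgue_measure.-integrable `[tau, s[ (EFin \o (fun u => `|y u| `^ alpha)).
Proof.
move=> tau0; apply: integrableS (integrable_powR_norm s alpha0 tau0 ylb) => //.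
exact: subset_itv_co_cc.
Qed.

(** The bound on [y] is only assumed strictly before [s], because that is what an
    induction hypothesis provides; one endpoint does not affect the integral. *)
Lemma Rintegral_le_barrier (K tau D s : R) :
  0 <= tau -> 0 <= K -> 0 < tau + D -> tau <= s ->
  (forall u : R, tau <= u < s -> `|y u| <= K * (u + D) `^ p) ->
  \int[lebesgue_measure]_(u in `[tau, s]) (`|y u| `^ alpha) <=
    K `^ alpha * (p^-1 * ((s + D) `^ p - (tau + D) `^ p)).
Proof.
move=> tau0 K0 tauD taus yle.
have [int_b <-] := Rintegral_barrier K0 tauD taus.
have int_y := integrable_co s tau0.
rewrite -Rintegral_itv_bndo_bndc //; apply: le_Rintegral => // u.
rewrite /= in_itv /= => /yle yu.
by rewrite ge0_ler_powR // nnegrE // mulr_ge0 // powR_ge0.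
Qed.

Lemma Rintegral_ge_barrier (K tau D s : R) :
  0 <= tau -> 0 <= K -> 0 < tau + D -> tau <= s ->
  (forall u : R, tau <= u < s -> K * (u + D) `^ p <= `|y u|) ->
  K `^ alpha * (p^-1 * ((s + D) `^ p - (tau + D) `^ p)) <=
    \int[lebesgue_measure]_(u in `[tau, s]) (`|y u| `^ alpha).
Proof.
move=> tau0 K0 tauD taus yle.
have [int_b <-] := Rintegral_barrier K0 tauD taus.
have int_y := integrable_co s tau0.
rewrite -Rintegral_itv_bndo_bndc //; apply: le_Rintegral => // u.
rewrite /= in_itv /= => /yle yu.
by rewrite ge0_ler_powR // nnegrE // mulr_ge0 // powR_ge0.
Qed.

(** One Lipschitz constant serves all intervals below [T], so an increment can be
    controlled near a point before the other end of the interval is chosen. *)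
Lemma Rintegral_increment (tau T : R) : 0 <= tau ->
  exists2 B : R, 0 <= B & forall s t : R, tau <= s -> s <= t -> t <= T ->
  0 <= \int[lebesgue_measure]_(u in `[tau, t]) (`|y u| `^ alpha) -
       \int[lebesgue_measure]_(u in `[tau, s]) (`|y u| `^ alpha) <= B * (t - s).
Proof.
move=> tau0; have [M yM] := bounded_on_segment T ylb.
exists (M `^ alpha) => [|s t taus st tT]; first exact: powR_ge0.
have int_y := integrable_powR_norm t alpha0 tau0 ylb.
rewrite Rintegral_itvB ?bnd_simp //; apply/andP; split.
  by apply: Rintegral_ge0 => u _; exact: powR_ge0.
have -> : M `^ alpha * (t - s) =
    \int[lebesgue_measure]_(u in `]s, t]) (M `^ alpha).
  rewrite Rintegral_cst //=; congr *%R.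
  move: st; rewrite le_eqVlt => /predU1P[<-|st].
    by rewrite lebesgue_measure_itv /= ltxx subrr.
  by rewrite lebesgue_measure_itv /= lte_fin st.
apply: le_Rintegral => //.
- by apply: integrableS int_y => //; apply: subset_itvr; rewrite bnd_simp.
- apply: measurable_bounded_integrable => //; last exact: bounded_cst.
  by rewrite /= lebesgue_measure_itv /=; case: ifP => _; rewrite -?EFinB ltry.
- move=> u /=; rewrite in_itv /= => /andP[su ut].
  have yMu : `|y u| <= M.
    apply: yM; rewrite (le_trans ut) // andbT (le_trans tau0) //.
    by rewrite (le_trans taus) // ltW.
  by rewrite ge0_ler_powR // nnegrE // (le_trans _ yMu).
Qed.

End IntegralComparison.

(** * Induction along a half-line *)

(** If [P] failed somewhere, the infimum of the failures would be a point before
    which [P] holds, and the inductive step pushes [P] strictly past it.  The case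
    [t = s] of the step does the work of a closedness assumption on [P], which the
    comparison with a discontinuous [y] could not provide. *)
Lemma right_induction (R : realType) (tau : R) (P : R -> Prop) :
  (forall s : R, tau <= s -> (forall u : R, tau <= u < s -> P u) ->
     \forall t \near s, s <= t -> P t) ->
  forall t : R, tau <= t -> P t.
Proof.
move=> step t0 taut0; apply: contrapT => nPt0.
pose E := [set t | tau <= t /\ ~ P t].
have hE : has_inf E.
  by split; [exists t0 | exists tau => u []].
have tauE : tau <= inf E by apply: lb_le_inf; [exact: hE.1 | move=> u []].
have Pbelow u : tau <= u < inf E -> P u.
  move=> /andP[tauu uE]; apply: contrapT => nPu.
  by have := ge_inf hE.2 (conj tauu nPu : E u); rewrite leNgt uE.
have /nbhs_ballP[d /= d0 Pd] := step _ tauE Pbelow.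
have [u [tauu nPu] uE] := inf_adherent d0 hE.
have Eu : inf E <= u by apply: ge_inf; [exact: hE.2 | split].
apply: nPu; apply: Pd => //.
by rewrite /ball /= distrC ger0_norm ?subr_ge0 // ltrBlDl.
Qed.

(** * Barriers *)

Section Barriers.
Variables (R : realType) (y : R -> R) (alpha p c tau D eps A : R).
Hypotheses (alpha0 : 0 <= alpha) (p0 : 0 < p) (alphap : alpha * p = p - 1).
Hypothesis (ylb : measurable_locally_bounded y).
Hypotheses (c0 : 0 <= c) (tau0 : 0 <= tau) (tauD : 0 < tau + D).
Hypothesis eps0 : 0 <= eps.

Let powR_near (X s e : R) : tau <= s -> 0 < e ->
  \forall t \near s, `|X * (s + D) `^ p - X * (t + D) `^ p| < e.
Proof.
move=> taus e0.
have sD : 0 < s + D by rewrite (lt_le_trans tauD) // lerD2r.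
have : X * (t + D) `^ p @[t --> s] --> X * (s + D) `^ p.
  by apply: cvgM; [exact: cvg_cst | exact: powR_shift_continuous].
by move=> /cvgrPdist_lt; apply.
Qed.

Let powR_tau_le (t : R) : tau <= t -> (t - tau) `^ p <= (t + D) `^ p.
Proof.
move=> taut; apply: ge0_ler_powR; rewrite ?nnegrE ?(ltW p0) //.
- by rewrite subr_ge0.
- by rewrite (le_trans (ltW tauD)) // lerD2r.
- by have := tauD; lra.
Qed.

(** If the barrier [K * (u + D) `^ p] dominates [y] before [s], then it dominates
    the integral term at [s] with the margin [e] to spare.  The integral term and
    the barrier vary continuously, so for [t] close to [s] neither uses up more
    than half of this margin. *)
Lemma upper_barrier (K : R) :
  (forall t : R, tau <= t -> 0 <= y t) ->
  0 < K -> c * p^-1 * K `^ alpha + eps <= K ->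
  A < c * p^-1 * K `^ alpha * (tau + D) `^ p ->
  (forall t : R, tau <= t -> y t <= A + eps * (t - tau) `^ p +
     c * \int[lebesgue_measure]_(s in `[tau, t]) (`|y s| `^ alpha)) ->
  forall t : R, tau <= t -> y t <= K * (t + D) `^ p.
Proof.
move=> y0 K0 KE AE yE.
pose I t := \int[lebesgue_measure]_(s in `[tau, t]) (`|y s| `^ alpha).
pose X := c * p^-1 * K `^ alpha.
apply: right_induction => s taus yle.
have Is : c * I s <= X * (s + D) `^ p - X * (tau + D) `^ p.
  have -> : X * (s + D) `^ p - X * (tau + D) `^ p =
    c * (K `^ alpha * (p^-1 * ((s + D) `^ p - (tau + D) `^ p))).
    by rewrite /X; ring.
  rewrite ler_wpM2l //; apply: Rintegral_le_barrier => // [|u us]; first exact: ltW.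
  by rewrite ger0_norm; [exact: yle | case/andP: us => /y0].
have [B B0 incr] := Rintegral_increment alpha0 ylb (s + 1) tau0.
pose e := X * (tau + D) `^ p - A.
have e0 : 0 < e by rewrite subr_gt0.
have eB : 0 < e / 2 / (c * B + 1).
  by rewrite !divr_gt0 // ltr_wpDl // mulr_ge0.
near=> t => st.
have taut := le_trans taus st.
have : I t - I s <= B * (t - s).
  suff /(incr _ _ taus st)/andP[] : t <= s + 1 by [].
  by apply: ltW; near: t; apply: lt_nbhsl; rewrite ltrDl.
move=> /(ler_wpM2l c0) It.
have : `|X * (s + D) `^ p - X * (t + D) `^ p| < e / 2.
  by near: t; apply: powR_near => //; rewrite divr_gt0.
rewrite ltr_norml => /andP[_ Xt].
have : c * (B * (t - s)) <= e / 2.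
  have ts : t - s <= e / 2 / (c * B + 1).
    by rewrite lerBlDl; apply: ltW; near: t; apply: lt_nbhsl; rewrite ltrDl.
  have cB : 0 <= c * B by rewrite mulr_ge0.
  rewrite ler_pdivlMr ?ltr_wpDl // in ts.
  by apply: le_trans ts; rewrite mulrA [leLHS]mulrC ler_wpM2l ?subr_ge0 // lerDl.
have yt := yE t taut.
rewrite -/(I t) in yt.
have := ler_wpM2l eps0 (powR_tau_le taut).
have := ler_wpM2r (powR_ge0 (t + D) p) KE.
rewrite mulrDl -/X => KX epsD cBt.
rewrite mulrBr in It.
have eE : e = X * (tau + D) `^ p - A by [].
lra.
Unshelve. all: by end_near. Qed.

(** Same argument as for [upper_barrier]; here the integral up to [t] is bounded
    below by the integral up to [s], so that the whole margin can be spent on the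
    barrier. *)
Lemma lower_barrier (k : R) :
  0 < k -> k + eps <= c * p^-1 * k `^ alpha ->
  c * p^-1 * k `^ alpha * (tau + D) `^ p < A ->
  (forall t : R, tau <= t -> A - eps * (t - tau) `^ p +
     c * \int[lebesgue_measure]_(s in `[tau, t]) (`|y s| `^ alpha) <= y t) ->
  forall t : R, tau <= t -> k * (t + D) `^ p <= y t.
Proof.
move=> k0 kE AE yE.
pose I t := \int[lebesgue_measure]_(s in `[tau, t]) (`|y s| `^ alpha).
pose X := c * p^-1 * k `^ alpha.
apply: right_induction => s taus yge.
have Is : X * (s + D) `^ p - X * (tau + D) `^ p <= c * I s.
  have -> : X * (s + D) `^ p - X * (tau + D) `^ p =
    c * (k `^ alpha * (p^-1 * ((s + D) `^ p - (tau + D) `^ p))).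
    by rewrite /X; ring.
  rewrite ler_wpM2l //; apply: Rintegral_ge_barrier => // [|u us]; first exact: ltW.
  by apply: le_trans (ler_norm _); exact: yge.
pose e := A - X * (tau + D) `^ p.
have e0 : 0 < e by rewrite subr_gt0.
near=> t => st.
have taut := le_trans taus st.
have [B _ incr] := Rintegral_increment alpha0 ylb t tau0.
have /andP[+ _] := incr s t taus st (lexx _).
rewrite -/(I t) -/(I s) => /(mulr_ge0 c0) It.
have : `|X * (s + D) `^ p - X * (t + D) `^ p| < e.
  by near: t; apply: powR_near.
rewrite ltr_norml => /andP[Xt _].
have yt := yE t taut.
rewrite -/(I t) in yt.
have := ler_wpM2l eps0 (powR_tau_le taut).
have := ler_wpM2r (powR_ge0 (t + D) p) kE.
rewrite mulrDl -/X => kX epsD.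
rewrite mulrBr in It.
have eE : e = A - X * (tau + D) `^ p by [].
lra.
Unshelve. all: by end_near. Qed.

End Barriers.

(** * Restarting the equation *)

(** The constant [C] accounts for the values of [h] before the little-o bound sets
    in. *)
Lemma littleo_powR_bound (R : realType) (h : R -> R) (p eps : R) :
  measurable_locally_bounded h ->
  h =o_ (pinfty_nbhs R) (fun t : R => t `^ p) -> 0 < eps ->
  exists C : R, forall s : R, 0 <= s -> h s <= C + eps * s `^ p.
Proof.
move=> hlb /eqoP ho eps0.
have [S [_ hS]] := ho _ eps0.
have [M hM] := bounded_on_segment S hlb.
exists `|M| => s s0; have [sS|Ss] := leP s S.
  apply: le_trans (ler_norm _) _; apply: le_trans (hM s _) _; first by rewrite s0.
  by apply: le_trans (ler_norm _) _; rewrite lerDl mulr_ge0 ?powR_ge0 // ltW.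
apply: le_trans (ler_norm _) _; apply: le_trans (hS s Ss) _.
by rewrite ger0_norm ?powR_ge0 // lerDr.
Qed.

(** The equation can be restarted at arbitrarily late times [tau] with an error that
    is small at the scale [(t - tau) `^ p].  The order of the quantifiers matters:
    [C] is fixed before [tau], so [y tau] can be made large compared with [C]. *)
Definition restartable (R : realType) (y : R -> R) (c alpha p : R) :=
  forall eps : R, 0 < eps -> exists C : R, forall T : R, exists tau : R,
    [/\ 0 <= tau, T <= tau & forall t : R, tau <= t ->
      `|y t - (y tau +
          c * \int[lebesgue_measure]_(s in `[tau, t]) (`|y s| `^ alpha))| <=
        C + eps * (t - tau) `^ p].

Lemma restartable_solution (R : realType) (c x alpha p : R) (g y h : R -> R)
    (t_ : R ^nat) :
  0 <= alpha -> measurable_locally_bounded y ->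
  (forall t : R, 0 <= t ->
     y t = x + c * \int[lebesgue_measure]_(s in `[0, t]) (`|y s| `^ alpha) + g t) ->
  (forall n, 0 <= t_ n) -> t_ n @[n --> \oo] --> +oo ->
  measurable_locally_bounded h ->
  h =o_ (pinfty_nbhs R) (fun t : R => t `^ p) ->
  (forall n t, t_ n <= t -> `|g t - g (t_ n)| <= h (t - t_ n)) ->
  restartable y c alpha p.
Proof.
move=> alpha0 ylb yE tn0 tny hlb ho gh eps eps0.
have [C hC] := littleo_powR_bound hlb ho eps0.
exists C => T.
have [n _ /(_ n (leqnn n)) Tn] := (cvgryPge _).1 tny T.
exists (t_ n); split => // t tnt.
have tau0 := tn0 n.
have t0 := le_trans tau0 tnt.
have split_int : \int[lebesgue_measure]_(s in `[0, t]) (`|y s| `^ alpha) =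
    \int[lebesgue_measure]_(s in `[0, t_ n]) (`|y s| `^ alpha) +
    \int[lebesgue_measure]_(s in `[t_ n, t]) (`|y s| `^ alpha).
  apply/eqP; rewrite addrC -subr_eq; apply/eqP.
  rewrite Rintegral_itvB ?bnd_simp //; last exact: integrable_powR_norm.
  rewrite Rintegral_itv_obnd_cbnd //.
  apply: integrableS (integrable_powR_norm t alpha0 tau0 ylb) => //.
  exact: subset_itv_oc_cc.
have -> : y t - (y (t_ n) +
    c * \int[lebesgue_measure]_(s in `[t_ n, t]) (`|y s| `^ alpha)) =
    g t - g (t_ n).
  by rewrite (yE t t0) (yE _ tau0) split_int; ring.
by apply: le_trans (gh n t tnt) (hC _ _); rewrite subr_ge0.
Qed.

(** * Asymptotics *)

Section Asymptotics.
Variables (R : realType) (y : R -> R) (c alpha p : R).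
Hypotheses (c0 : 0 < c) (alpha0 : 0 <= alpha) (p1 : 1 <= p).
Hypothesis alphap : alpha * p = p - 1.
Hypothesis ylb : measurable_locally_bounded y.
Hypothesis yy : y t @[t --> +oo] --> +oo.
Hypothesis yr : restartable y c alpha p.

Let p0 : 0 < p. Proof. exact: lt_le_trans p1. Qed.
Let gam := c * p^-1.
Let gam0 : 0 < gam. Proof. by rewrite /gam divr_gt0. Qed.

(* For [q = 1] this says that [gam `^ p] is the fixed point of
   [K |-> gam * K `^ alpha]; the factor [q] measures the distance to it. *)
Let rate_fixpoint (q : R) : 0 < q ->
  gam * ((gam * q) `^ p) `^ alpha = (gam * q) `^ p / q.
Proof.
move=> q0; have gq : 0 <= gam * q by rewrite mulr_ge0 // ltW.
rewrite -powRrM [p * _]mulrC alphap -(mulr_powRB1 gq p0).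
by rewrite -[gam * q * _]mulrA [q * _]mulrC mulrA mulfK // gt_eqF.
Qed.

Let rate_rescale (q t : R) : 0 < q -> 0 <= t ->
  (gam * q) `^ p * (q * t) `^ p = (q * q) `^ p * (gam * t) `^ p.
Proof.
move=> /ltW q0 t0; move: gam (ltW gam0) => G G0.
by rewrite !powRM ?mulr_ge0 //; ring.
Qed.

Let y_large (B : R) : exists T : R, forall t, T <= t -> B <= y t.
Proof.
have [M [_ yM]] := (cvgryPge _).1 yy B.
by exists (M + 1) => t Mt; apply: yM; rewrite (lt_le_trans _ Mt) // ltrDl.
Qed.

(** One factor [q] makes [K = (gam * q) `^ p] a strict supersolution, the other one
    absorbs the shift: [t + D <= q * t] for large [t]. *)
Lemma eventually_le_rate (q : R) : 1 < q ->
  \forall t \near +oo, y t <= (q * q) `^ p * (c * p^-1 * t) `^ p.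
Proof.
move=> q1; have q0 : 0 < q by rewrite (lt_trans _ q1).
pose K := (gam * q) `^ p.
have K0 : 0 < K by rewrite powR_gt0 // mulr_gt0.
have XE : c * p^-1 * K `^ alpha = K / q by exact: rate_fixpoint.
have X0 : 0 < K / q by rewrite divr_gt0.
have eps0 : 0 < K - K / q by rewrite subr_gt0 ltr_pdivrMr // ltr_pMr.
have [C yC] := yr eps0.
have [T yT] := y_large 0.
have [tau [tau0 Ttau {}yC]] := yC T.
pose A := y tau + C.
(* The summand 1 ensures [D <= D `^ p], which turns a lower bound on [D] into one
   on the barrier at [tau]. *)
pose D := 1 + `|A| / (K / q).
have D1 : 1 <= D by rewrite lerDl divr_ge0 // ltW.
have AD : A < K / q * (tau + D) `^ p.
  have D_le : D <= (tau + D) `^ p.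
    by apply: le_trans (le1r_powR _ p1); rewrite ?lerDr // (le_trans D1) // lerDr.
  apply: le_lt_trans (ler_norm _) _.
  rewrite mulrC -ltr_pdivrMr //; apply: lt_le_trans D_le.
  by rewrite /D ltrDr.
have yD : forall t : R, tau <= t -> y t <= K * (t + D) `^ p.
  apply: (upper_barrier (c := c) (eps := K - K / q) (A := A)
    (alpha := alpha)) => //.
  - exact: ltW.
  - by rewrite ltr_wpDl // (lt_le_trans _ D1).
  - exact: ltW.
  - by move=> t /(le_trans Ttau); exact: yT.
  - by rewrite XE; lra.
  - by rewrite XE.
  - by move=> t /yC; rewrite ler_norml /A => /andP[_]; lra.
near=> t.
have t0 : 0 <= t by near: t; apply: nbhs_pinfty_ge; exact: num_real.
have taut : tau <= t by near: t; apply: nbhs_pinfty_ge; exact: num_real.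
have tD : t + D <= q * t.
  have : D / (q - 1) <= t by near: t; apply: nbhs_pinfty_ge; exact: num_real.
  by rewrite ler_pdivrMr ?subr_gt0 //; lra.
apply: le_trans (yD t taut) _; rewrite -rate_rescale // ler_wpM2l ?(ltW K0) //.
by rewrite ge0_ler_powR ?nnegrE ?(ltW p0) //; lra.
Unshelve. all: by end_near. Qed.

(** Here the starting height of the barrier is prescribed and the restarting time
    [tau] is adapted to it: [y tau - C] exceeds [k / q] for late [tau]. *)
Lemma eventually_ge_rate (q : R) : 0 < q < 1 ->
  \forall t \near +oo, (q * q) `^ p * (c * p^-1 * t) `^ p <= y t.
Proof.
move=> /andP[q0 q1].
pose k := (gam * q) `^ p.
have k0 : 0 < k by rewrite powR_gt0 // mulr_gt0.
have XE : c * p^-1 * k `^ alpha = k / q by exact: rate_fixpoint.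
have X0 : 0 < k / q by rewrite divr_gt0.
have eps0 : 0 < k / q - k by rewrite subr_gt0 ltr_pdivlMr // gtr_pMr.
have [C yC] := yr eps0.
have [T yT] := y_large (C + k / q + 1).
have [tau [tau0 Ttau {}yC]] := yC T.
(* The shift [1 - tau] makes the barrier start at [k], whatever [tau] is. *)
have yD : forall t : R, tau <= t -> k * (t + (1 - tau)) `^ p <= y t.
  apply: (lower_barrier (c := c) (eps := k / q - k) (A := y tau - C)
    (alpha := alpha)) => //.
  - exact: ltW.
  - by rewrite addrC subrK.
  - exact: ltW.
  - by rewrite XE; lra.
  - by rewrite XE addrC subrK powR1 mulr1; have := yT tau Ttau; lra.
  - by move=> t /yC; rewrite ler_norml => /andP[+ _]; lra.
near=> t.
have t0 : 0 <= t by near: t; apply: nbhs_pinfty_ge; exact: num_real.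
have taut : tau <= t by near: t; apply: nbhs_pinfty_ge; exact: num_real.
have tD : q * t <= t + (1 - tau).
  have : (tau - 1) / (1 - q) <= t.
    by near: t; apply: nbhs_pinfty_ge; exact: num_real.
  by rewrite ler_pdivrMr ?subr_gt0 //; lra.
apply: le_trans (yD t taut); rewrite -rate_rescale // ler_wpM2l ?(ltW k0) //.
have qt : 0 <= q * t by rewrite mulr_ge0 // ltW.
by rewrite ge0_ler_powR ?nnegrE ?(ltW p0) // (le_trans qt).
Unshelve. all: by end_near. Qed.

Lemma cvg_rate : y t / (c * p^-1 * t) `^ p @[t --> +oo] --> (1 : R).
Proof.
have cvg1 : (q * q) `^ p @[q --> (1 : R)] --> (1 : R).
  have cont : {for (1 : R), continuous (fun q : R => (q * q) `^ p)}.
    apply: (@continuous_comp R R R (fun q : R => q * q) (@powR R ^~ p)).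
      by apply: cvgM; exact: cvg_id.
    apply: differentiable_continuous; apply/derivable1_diffP.
    by have [] := is_derive1_powR p (mulr_gt0 (@ltr01 R) (@ltr01 R)).
  by rewrite -[X in _ --> X](_ : (1 * 1) `^ p = 1) // mulr1 powR1.
apply/cvgrPdist_le => e e0.
have near1 : \forall q \near (1 : R), `|1 - (q * q) `^ p| <= e.
  by move/cvgrPdist_le : cvg1; apply.
have [q1 q1_gt1 q1e] : exists2 q : R, 1 < q & (q * q) `^ p <= 1 + e.
  near (1 : R)^'+ => q; exists q => //.
  have : `|1 - (q * q) `^ p| <= e by near: q; exact: cvg_within near1.
  by rewrite ler_norml; lra.
have [q2 q2_lt1 q2e] : exists2 q : R, 0 < q < 1 & 1 - e <= (q * q) `^ p.
  near (1 : R)^'- => q; exists q => //.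
    by apply/andP; split => //; near: q; exact: nbhs_left_gt.
  have : `|1 - (q * q) `^ p| <= e by near: q; exact: cvg_within near1.
  by rewrite ler_norml; lra.
near=> t.
have t0 : 0 < t by near: t; apply: nbhs_pinfty_gt; exact: num_real.
have z0 : 0 < (c * p^-1 * t) `^ p by rewrite powR_gt0 // mulr_gt0.
rewrite distrC ler_distl; apply/andP; split.
  rewrite ler_pdivlMr //.
  have yge : (q2 * q2) `^ p * (c * p^-1 * t) `^ p <= y t.
    by near: t; exact: eventually_ge_rate.
  by apply: le_trans yge; rewrite ler_wpM2r // ltW.
rewrite ler_pdivrMr //.
have yle : y t <= (q1 * q1) `^ p * (c * p^-1 * t) `^ p.
  by near: t; exact: eventually_le_rate.
by apply: le_trans yle _; rewrite ler_wpM2r // ltW.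
Unshelve. all: by end_near. Qed.

End Asymptotics.

Theorem theorem3p1 (R : realType) (c x alpha : R) (g y : R -> R) :
  0 < c -> 0 < x -> 0 < alpha < 1 ->
  measurable_locally_bounded g ->
  measurable_locally_bounded y ->
  (forall t : R, 0 <= t ->
     y t = x + c * \int[lebesgue_measure]_(s in `[0, t]) (`|y s| `^ alpha) + g t) ->
  y t @[t --> +oo] --> +oo ->
  (exists (t_ : R ^nat) (h : R -> R),
     [/\ forall n, 0 <= t_ n,
         t_ n @[n --> \oo] --> +oo,
         measurable_locally_bounded h,
         h =o_ (pinfty_nbhs R) (fun t : R => t `^ (1 - alpha)^-1)
       & forall n t, t_ n <= t -> `|g t - g (t_ n)| <= h (t - t_ n)]) ->
  asymp_equiv_pinfty y (fun t => (c * (1 - alpha) * t) `^ (1 - alpha)^-1).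
Proof.
move=> c0 _ /andP[alpha0 alpha1] _ ylb yE yy [t_ [h [tn0 tny hlb ho gh]]].
have na0 : 0 < 1 - alpha by rewrite subr_gt0.
have rateE : c * (1 - alpha) = c * ((1 - alpha)^-1)^-1 by rewrite invrK.
rewrite /asymp_equiv_pinfty rateE.
apply: (cvg_rate (alpha := alpha)) => //.
- exact: ltW.
- by rewrite invf_ge1 // gerBl ltW.
- apply: (mulIf (lt0r_neq0 na0)).
  by rewrite mulrBl mulfVK ?gt_eqF // mulVf ?gt_eqF //; ring.
- exact: (restartable_solution (ltW alpha0) ylb yE tn0 tny hlb ho gh).
Qed.
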